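(* Let $K$ be a commutative ring with division by integers, let $n\ge1$, and let $\widetilde{A}=(a_{ij}^{(k)})_{i,j,k=1}^{n}$ be an $n\times n\times n$ space matrix over $K$. Then \[ Det_p(\widetilde{A})=\Big[\sum_{\sigma\in S_n^{(e)}}\prod_{t=1}^{n}\Big(\sum_{i=1}^{n}a^{(i)}_{t\sigma(i)}\Big)-\sum_{\sigma\in S_n^{(o)}}\prod_{t=1}^{n}\Big(\sum_{i=1}^{n}a^{(i)}_{t\sigma(i)}\Big)\Big] \] \[ -\Big[\sum_{\sigma\in S_n^{(e)}}\sum_{s=1}^{n}\prod_{t=1}^{n}\Big(-a^{(s)}_{t\sigma(s)}+\sum_{i=1}^{n}a^{(i)}_{t\sigma(i)}\Big)-\sum_{\sigma\in S_n^{(o)}}\sum_{s=1}^{n}\prod_{t=1}^{n}\Big(-a^{(s)}_{t\sigma(s)}+\sum_{i=1}^{n}a^{(i)}_{t\sigma(i)}\Big)\Big]. \]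
   Context: ''With division by integers'' means that for every positive integer $m$, multiplication by $m$ is a bijection of $K$. $S_n$ is the set of permutations of $\{1,\dots,n\}$; $S_n^{(e)}$ and $S_n^{(o)}$ are its subsets of even and odd permutations; $d(\sigma)$ is the number of inversions of $\sigma$. For an $n\times n$ matrix $C=(c_{ij})$ over $K$, $per(C)=\sum_{\sigma\in S_n}c_{1\sigma(1)}\cdots c_{n\sigma(n)}$; for column vectors $v_1,\dots,v_n\in K^n$, $per(v_1,\dots,v_n)$ is the permanent of the matrix with columns $v_1,\dots,v_n$. For $k,j\in\{1,\dots,n\}$ let $\alpha^{(k)}_j=(a^{(k)}_{1j},a^{(k)}_{2j},\dots,a^{(k)}_{nj})^T$ be the $j$-th column of the section $A_k=(a^{(k)}_{ij})_{i,j}$. Define \[ Det_p(\widetilde{A}):=\sum_{\sigma\in S_n}(-1)^{d(\sigma)}\,per\big(\alpha^{(1)}_{\sigma(1)},\alpha^{(2)}_{\sigma(2)},\dots,\alpha^{(n)}_{\sigma(n)}\big). \] *)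

(* Defs.v *)
From mathcomp Require Import all_boot all_order all_algebra all_fingroup.

Set Implicit Arguments.
Unset Strict Implicit.
Unset Printing Implicit Defensive.

Import GRing.Theory.
Local Open Scope ring_scope.

(* Rings are unital; [comPzRingType] does not exclude the zero ring. *)
Definition division_by_integers (K : comPzRingType) : Prop :=
  forall m : nat, (0 < m)%N -> bijective (fun x : K => x *+ m).

(* The section A_k is [A k], so the entry a_ij^(k) is [A k i j]; the indices
   1, ..., n are represented by 'I_n. *)
Definition space_matrix (K : comPzRingType) (n : nat) : Type :=
  'I_n -> 'M[K]_n.

Definition inversions (n : nat) (s : 'S_n) : nat :=
  #|[set p : 'I_n * 'I_n | (p.1 < p.2)%N && (s p.2 < s p.1)%N]|.

Definition per (K : comPzRingType) (n : nat) (C : 'M[K]_n) : K :=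
  \sum_(s : 'S_n) \prod_(i < n) C i (s i).

Definition per_cols (K : comPzRingType) (n : nat) (v : 'I_n -> 'cV[K]_n) : K :=
  per (\matrix_(i < n, j < n) v j i 0).

Definition Det_p (K : comPzRingType) (n : nat) (A : space_matrix K n) : K :=
  \sum_(s : 'S_n) (-1) ^+ inversions s * per_cols (fun k => col (s k) (A k)).

(* Main.v *)
(* Expanding the products on the right over maps f from row indices to section
   indices, the map f contributes the signed sum over s of
   prod_t A (f t) t (s (f t)), with coefficient 1 minus the number of indices
   missed by f.  Bijective f have coefficient 1 and add up to Det_p; maps missing
   exactly one index have coefficient 0; if f misses two indices, precomposing s
   with their transposition flips the sign and fixes the product, so the signed
   sum vanishes. *)
Require Import Defs.
From mathcomp Require Import all_boot all_order all_algebra all_fingroup.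

Set Implicit Arguments.
Unset Strict Implicit.
Unset Printing Implicit Defensive.

Import GRing.Theory Num.Theory.
Local Open Scope ring_scope.

(* Permuting the columns of the Vandermonde determinant of 0, ..., n-1
   multiplies it by the parity sign, while the factors of its product formula
   that become negative are indexed by the inversions. *)
Lemma sign_inversions (R : pzRingType) (n : nat) (s : 'S_n) :
  (-1) ^+ inversions s = (-1) ^+ s :> R.
Proof.
(* In [R] the elements 1 and -1 may coincide, so parities are compared in [int], where they can be
   read off from signs. *)
suff eq_sign : (-1) ^+ inversions s = (-1) ^+ s :> int.
  rewrite -signr_odd; congr (_ ^+ nat_of_bool _).
  by move: eq_sign; rewrite -signr_odd; case: odd; case: (odd_perm s).
pose x : 'rV[int]_n := \row_j (j%:Z).
have pos_x : Num.sg (\det (Vandermonde n x)) = 1.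
  rewrite gtr0_sg // det_Vandermonde.
  by do 2!(apply: prodr_gt0 => ? ?); rewrite !mxE subr_gt0.
have det_s : \det (Vandermonde n (\row_j x 0 (s j))) =
    (-1) ^+ s * \det (Vandermonde n x).
  have -> : Vandermonde n (\row_j x 0 (s j)) = col_perm s (Vandermonde n x).
    by apply/matrixP=> i j; rewrite !mxE.
  by rewrite col_permE det_mulmx det_perm odd_permV mulrC.
have /(congr1 Num.sg) := det_s.
rewrite sgrM pos_x mulr1 sgrX sgrN1 => <-.
rewrite det_Vandermonde pair_big_dep /=.
rewrite (big_morph _ (@sgrM _) (@sgr1 _)).
rewrite -[LHS]prodr_const.
rewrite [RHS](bigID (fun p : 'I_n * 'I_n => (s p.2 < s p.1)%N)) /=.
rewrite [X in _ = _ * X]big1 ?mulr1.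
  apply: eq_big => [p|p]; first by rewrite inE.
  by rewrite inE => /andP[_ lt_s]; rewrite !mxE ltr0_sg // subr_lt0.
move=> p /andP[lt_p]; rewrite -leqNgt => le_s; rewrite !mxE gtr0_sg //.
rewrite subr_gt0 ltz_nat ltn_neqAle le_s andbT.
by apply: contraTneq lt_p => /ord_inj/perm_inj ->; rewrite ltnn.
Qed.

(** Left multiplication by [tperm i j] matches even with odd permutations, so terms cancel in pairs,
    with no division by 2. *)
Lemma alternating_sum_tperm (R : pzRingType) (n : nat) (F : 'S_n -> R)
    (i j : 'I_n) :
  i != j -> (forall s, F (tperm i j * s)%g = F s) ->
  \sum_(s : 'S_n) (-1) ^+ s * F s = 0.
Proof.
move=> neq_ij invF; rewrite (bigID (@odd_perm _)) /= addrC.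
apply: canLR (subrK _) _; rewrite add0r -sumrN.
rewrite (reindex_inj (mulgI (tperm i j))) /=.
apply: eq_big => s; rewrite odd_mul_tperm neq_ij /= negbK // => ->.
by rewrite invF mul1r mulN1r opprK.
Qed.

Lemma sum_sign_split (R : pzRingType) (n : nat) (F : 'S_n -> R) :
  \sum_(s : 'S_n | ~~ odd_perm s) F s - \sum_(s : 'S_n | odd_perm s) F s =
  \sum_(s : 'S_n) (-1) ^+ s * F s.
Proof.
rewrite [RHS](bigID (@odd_perm _)) [RHS]addrC -sumrN /=; congr (_ + _).
  by apply: eq_bigr => s /negbTE ->; rewrite mul1r.
by apply: eq_bigr => s ->; rewrite mulN1r.
Qed.

(** The term [- F i r] deletes [r] from the inner sum, so expanding leaves only maps that avoid
    [r]. *)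
Lemma prod_sum_diff (R : comPzRingType) (I J : finType) (F : I -> J -> R)
    (r : J) :
  \prod_i (- F i r + \sum_j F i j) =
  \sum_(f : {ffun I -> J} | r \notin codom f) \prod_i F i (f i).
Proof.
transitivity (\prod_i \sum_(j | j != r) F i j).
  by apply: eq_bigr => i _; rewrite (bigD1 r) //= addKr.
rewrite bigA_distr_big; apply: eq_bigl => f; apply/ffun_onP/idP.
  by move=> neq_r; apply/codomP=> -[i def_r]; case/eqP: (neq_r i).
by move=> nr i; apply: contraNneq nr => <-; apply: codom_f.
Qed.

(** The permutation summed over in the permanent becomes the map [f] from rows to sections. *)
Lemma Det_p_injectiveE (K : comPzRingType) (n : nat) (A : space_matrix K n) :
  Det_p A = \sum_(f : {ffun 'I_n -> 'I_n} | injectiveb f) \sum_(s : 'S_n)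
    (-1) ^+ s * \prod_(t < n) A (f t) t (s (f t)).
Proof.
rewrite exchange_big; apply: eq_bigr => s _; rewrite sign_inversions.
rewrite -big_distrr; congr (_ * _).
rewrite (reindex (@pval _)) /=; last first.
  exists (insubd (1%g : 'S_n)) => [f _ | f /[!inE] inj_f]; first exact: valKd.
  by rewrite -[LHS]/(val _) insubdK.
apply: eq_big => [p|p _]; first by rewrite (valP p).
by apply: eq_bigr => i _; rewrite !mxE pvalE.
Qed.

Theorem theorem5 (K : comPzRingType) (hK : division_by_integers K)
    (n : nat) (hn : (0 < n)%N) (A : space_matrix K n) :
  Det_p A =
    (\sum_(s : 'S_n | ~~ odd_perm s) \prod_(t < n) (\sum_(i < n) A i t (s i))
     - \sum_(s : 'S_n | odd_perm s) \prod_(t < n) (\sum_(i < n) A i t (s i)))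
    - (\sum_(s : 'S_n | ~~ odd_perm s) \sum_(r < n)
         \prod_(t < n) (- A r t (s r) + \sum_(i < n) A i t (s i))
       - \sum_(s : 'S_n | odd_perm s) \sum_(r < n)
         \prod_(t < n) (- A r t (s r) + \sum_(i < n) A i t (s i))).
Proof.
pose M (s : 'S_n) (f : {ffun 'I_n -> 'I_n}) := \prod_(t < n) A (f t) t (s (f t)).
pose missed (f : {ffun 'I_n -> 'I_n}) := [set r | r \notin codom f].
have sumM (s : 'S_n) : \prod_(t < n) (\sum_(i < n) A i t (s i)) = \sum_f M s f.
  by rewrite bigA_distr_bigA.
have sumM_missed (s : 'S_n) : \sum_(r < n)
    \prod_(t < n) (- A r t (s r) + \sum_(i < n) A i t (s i)) =
    \sum_f M s f *+ #|missed f|.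
  under eq_bigr => r _ do
    rewrite (prod_sum_diff (fun t i => A i t (s i))) big_mkcond.
  (* After the exchange, each [f] is counted once per index it misses. *)
  rewrite exchange_big; apply: eq_bigr => f _.
  by rewrite -big_mkcond -sumr_const; apply: eq_bigl => r; rewrite inE.
rewrite !sum_sign_split -sumrB Det_p_injectiveE.
under [RHS]eq_bigr => s _ do
  rewrite sumM sumM_missed -mulrBr -sumrB big_distrr.
rewrite [RHS]exchange_big [RHS](bigID (fun f : {ffun _} => injectiveb f)) /=.
rewrite [X in _ = _ + X]big1 ?addr0.
  apply: eq_bigr => f /injectiveP inj_f; apply: eq_bigr => s _.
  suff -> : missed f = set0 by rewrite cards0 subr0.
  by apply/setP=> r; rewrite !inE (inj_card_onto inj_f) ?card_ord.
move=> f ninj_f.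
have [->|missed_neq1] := eqVneq #|missed f| 1%N.
  by rewrite big1 // => s _; rewrite mulr1n subrr mulr0.
(* If [f] missed no index it would be onto, hence injective; as exactly one is excluded, it misses
   at least two. *)
have {missed_neq1} /card_gt1P[i [j [/[!inE] mi mj neq_ij]]] : (1 < #|missed f|)%N.
  rewrite ltn_neqAle eq_sym missed_neq1 card_gt0; apply: contra ninj_f => /eqP m0.
  have /image_injP inj_f : #|codom f| == #|'I_n|.
    apply/eqP/eq_card => r; apply/negbFE.
    by have /setP/(_ r) := m0; rewrite !inE.
  by apply/injectiveP => i j; apply: inj_f.
apply: (alternating_sum_tperm neq_ij) => s.
(* No [f t] equals [i] or [j], so the transposition fixes every argument at which [s] is
   evaluated. *)
suff -> : M (tperm i j * s)%g f = M s f by [].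
apply: eq_bigr => t _; rewrite permM tpermD //.
  by apply: contraNneq mi => ->; apply: codom_f.
by apply: contraNneq mj => ->; apply: codom_f.
Qed.
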